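(* There exists a unique invariant fluid model solution $\mathbf{z}^\ast=(z_1^\ast,\dots,z_I^\ast)$, and it is given by $$z_1^\ast=\frac{\lambda}{\mu_1+\nu\|\mathbf{z}^\ast\|_1}\,\|\mathbf{z}^\ast\|_1,\qquad z_i^\ast=\frac{\mu_{i-1}}{\mu_i+\nu\|\mathbf{z}^\ast\|_1}\,z_{i-1}^\ast,\quad 2\le i\le I,$$ where $\|\mathbf{z}^\ast\|_1$ solves $$f(\|\mathbf{z}^\ast\|_1):=\lambda\sum_{i=1}^I\frac{\prod_{l=1}^{i-1}\mu_l}{\prod_{l=1}^{i}(\mu_l+\nu\|\mathbf{z}^\ast\|_1)}=1$$ (the empty product being $1$).
   Context: Notation: $\mathbb{R}_+=[0,\infty)$, $\|\mathbf{x}\|_1=\sum_{i=1}^I |x_i|$ for $\mathbf{x}\in\mathbb{R}^I$. Parameters: an integer $I\ge 1$ and positive reals $\lambda,\mu_1,\dots,\mu_I,\nu$. Standing assumption (overload): $\lambda\sum_{i=1}^I 1/\mu_i>1$. Fluid model solution (FMS): a continuous function $\mathbf{z}=(z_1,\dots,z_I)\colon\mathbb{R}_+\to\mathbb{R}_+^I$ with $\inf_{t\ge\delta}\|\mathbf{z}(t)\|_1>0$ for every $\delta>0$ that satisfies, for all $t>0$, $$z_1'(t)=\lambda-\mu_1\frac{z_1(t)}{\|\mathbf{z}(t)\|_1}-\nu z_1(t),$$ $$z_i'(t)=\mu_{i-1}\frac{z_{i-1}(t)}{\|\mathbf{z}(t)\|_1}-\mu_i\frac{z_i(t)}{\|\mathbf{z}(t)\|_1}-\nu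 z_i(t),\quad 2\le i\le I.$$ An FMS is invariant if it is constant in time; it is identified with its constant value in $\mathbb{R}_+^I$. *)

(* Defs.v *)
From HB Require Import structures.
From mathcomp Require Import all_boot all_order all_algebra.
From mathcomp Require Import all_classical all_reals all_analysis.
Set Implicit Arguments.
Unset Strict Implicit.
Unset Printing Implicit Defensive.
Import Order.TTheory GRing.Theory Num.Theory.
Import numFieldNormedType.Exports.
Local Open Scope classical_set_scope.
Local Open Scope ring_scope.

(* Coordinates are indexed from 0: the mathematical index i in {1, ..., I} is
   the ordinal i - 1 in 'I_N with N = I. *)

Definition norm1 (R : realType) (N : nat) (x : 'rV[R]_N) : R :=
  \sum_(i < N) `|x 0 i|.

(* A function on [0, +oo[ is represented by a function on R of which only the
   values on [0, +oo[ are constrained. The set whose infimum is taken is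
   nonempty and bounded below by 0, so inf is the genuine infimum. *)
Record is_fluid_model_solution (R : realType) (N : nat) (lambda : R)
    (mu : 'I_N -> R) (nu : R) (z : R -> 'rV[R]_N) : Prop := {
  fms_continuous : {within `[0, +oo[, continuous z} ;
  fms_ge0 : forall (t : R) (i : 'I_N), 0 <= t -> 0 <= z t 0 i ;
  fms_inf_gt0 : forall delta : R, 0 < delta ->
    0 < inf [set norm1 (z t) | t in `[delta, +oo[] ;
  fms_ode_first : forall (t : R) (i : 'I_N), 0 < t -> i = 0%N :> nat ->
    is_derive t 1 (fun s => z s 0 i)
      (lambda - mu i * (z t 0 i / norm1 (z t)) - nu * z t 0 i) ;
  fms_ode_next : forall (t : R) (j i : 'I_N), 0 < t -> i = j.+1 :> nat ->
    is_derive t 1 (fun s => z s 0 i)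
      (mu j * (z t 0 j / norm1 (z t)) - mu i * (z t 0 i / norm1 (z t))
       - nu * z t 0 i) }.

Definition is_invariant_fms (R : realType) (N : nat) (lambda : R)
    (mu : 'I_N -> R) (nu : R) (z : R -> 'rV[R]_N) : Prop :=
  is_fluid_model_solution lambda mu nu z /\
  exists c : 'rV[R]_N, forall t : R, 0 <= t -> z t = c.

Definition fixed_point_fun (R : realType) (N : nat) (lambda : R)
    (mu : 'I_N -> R) (nu : R) (x : R) : R :=
  lambda * \sum_(i < N)
    ((\prod_(l < N | (l < i)%N) mu l) /
     (\prod_(l < N | (l <= i)%N) (mu l + nu * x))).

(* Main.v *)
Require Import Defs.
From HB Require Import structures.
From mathcomp Require Import all_boot all_order all_algebra.
From mathcomp Require Import all_classical all_reals all_analysis.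
From mathcomp Require Import ring lra.
Set Implicit Arguments.
Unset Strict Implicit.
Unset Printing Implicit Defensive.
Import Order.TTheory GRing.Theory Num.Theory.
Import numFieldNormedType.Exports.
Local Open Scope classical_set_scope.
Local Open Scope ring_scope.

(** An invariant solution is a constant vector c that annihilates the right-hand
    sides of the fluid equations. Once the total mass x = norm1 c is regarded as
    a parameter, these balance equations are linear and triangular: the first
    one determines c_1, and each of the others determines c_i from its
    predecessor ([balanced_weightE]). They force
      c_i = lambda * w_i(x) * x,
      w_i(x) = (mu_1 ... mu_(i-1)) / ((mu_1 + nu x) ... (mu_i + nu x)),
    and summing over i gives norm1 c = f(x) * x. So a nonzero equilibrium of
    mass x exists exactly when f(x) = 1, and x then determines it.

    It remains to see that f(x) = 1 has one and only one positive root. Each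
    w_i strictly decreases, hence so does f, which gives uniqueness
    ([fixed_point_fun_inj]). For existence ([fixed_point_fun_root]), f is
    continuous, overload says that f(0) > 1, and w_i(x) <= 1 / (nu x) gives
    f <= 1 at x = lambda N / nu, so the intermediate value theorem applies.

    The link with the differential equations is that a constant function has
    zero derivative; the condition on the infimum of the norm excludes c = 0,
    where the balance equations would involve a division by zero. *)

(** * The coefficients w_i and the fixed-point function *)

(** Induction along the line of stations, in the shape of the fluid
    equations: one case without predecessor, one case with. *)
Lemma ord_first_next_ind (N : nat) (P : 'I_N -> Prop) :
  (forall i : 'I_N, i = 0%N :> nat -> P i) ->
  (forall j i : 'I_N, i = j.+1 :> nat -> P j -> P i) -> forall i, P i.
Proof.
move=> P_first P_next i; have [n] := ubnP (val i).
elim: n i => // n IH i; rewrite ltnS => ni.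
case: (posnP i) => [/P_first//|i_gt0].
have ltj : (i.-1 < N)%N by rewrite (leq_ltn_trans (leq_pred _)).
apply: (P_next (Ordinal ltj)); first by rewrite /= prednK.
by apply: IH; rewrite /= prednK.
Qed.

(** The i-th summand of [fixed_point_fun]. In a queueing reading, it is the
    probability of completing the stages before i without abandoning, times the
    mean time spent at stage i, when stage l has service rate mu_l and
    abandonment rate nu x. *)
Definition station_weight (R : realType) (N : nat) (mu : 'I_N -> R) (nu : R)
    (i : 'I_N) (x : R) : R :=
  (\prod_(l < N | (l < i)%N) mu l) /
  (\prod_(l < N | (l <= i)%N) (mu l + nu * x)).

Section StationWeight.
Variables (R : realType) (N : nat) (mu : 'I_N -> R) (nu : R).
Hypotheses (mu_gt0 : forall i, 0 < mu i) (nu_gt0 : 0 < nu).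

Local Notation w := (station_weight mu nu).

Lemma outflow_rate_gt0 (l : 'I_N) (x : R) : 0 <= x -> 0 < mu l + nu * x.
Proof. by move=> x_ge0; rewrite ltr_wpDr// mulr_ge0// ltW. Qed.

Lemma station_weight_gt0 (i : 'I_N) (x : R) : 0 <= x -> 0 < w i x.
Proof.
by move=> x_ge0; rewrite divr_gt0// prodr_gt0// => l _; exact: outflow_rate_gt0.
Qed.

Lemma station_weight_first (i : 'I_N) (x : R) :
  i = 0%N :> nat -> w i x = (mu i + nu * x)^-1.
Proof.
move=> i0; rewrite /station_weight big_pred0; last by move=> l; rewrite i0.
rewrite (big_pred1 i) ?mul1r// => l.
by rewrite i0 leqn0 /= -val_eqE /= i0.
Qed.

Lemma station_weight_next (j i : 'I_N) (x : R) :
  i = j.+1 :> nat -> w i x = mu j / (mu i + nu * x) * w j x.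
Proof.
move=> ij.
have num : \prod_(l < N | (l < i)%N) mu l =
    mu j * \prod_(l < N | (l < j)%N) mu l.
  rewrite (bigD1 j) ?ij//=; congr (_ * _); apply: eq_bigl => l.
  by rewrite ltnS [RHS]ltn_neqAle andbC.
have den : \prod_(l < N | (l <= i)%N) (mu l + nu * x) =
    (mu i + nu * x) * \prod_(l < N | (l <= j)%N) (mu l + nu * x).
  rewrite (bigD1 i)//=; congr (_ * _); apply: eq_bigl => l.
  by rewrite -(ltnS l j) -ij [RHS]ltn_neqAle andbC.
by rewrite /station_weight num den invfM mulrACA.
Qed.

Lemma station_weight_decr (i : 'I_N) (x y : R) : 0 <= x -> x < y -> w i y < w i x.
Proof.
move=> x_ge0 xy; have y_ge0 : 0 <= y by rewrite (le_trans x_ge0)// ltW.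
have den_gt0 (v : R) :
    0 <= v -> 0 < \prod_(l < N | (l <= i)%N) (mu l + nu * v).
  by move=> v_ge0; apply: prodr_gt0 => l _; exact: outflow_rate_gt0.
rewrite ltr_pM2l ?prodr_gt0// ltf_pV2 ?posrE ?den_gt0//.
apply: ltr_prod; first by apply/hasP; exists i; rewrite ?mem_index_enum /=.
by move=> l _; rewrite ltW ?outflow_rate_gt0//= ltrD2l ltr_pM2l.
Qed.

(** A probability in the reading of [station_weight]: that of reaching stage i.
    Passing from j to its successor replaces the factor mu_j + nu x by mu_j.
    The weaker bound of [station_weight_le] would not survive this induction,
    since mu_j may exceed mu_i + nu x. *)
Lemma station_outflow_le1 (i : 'I_N) (x : R) :
  0 <= x -> (mu i + nu * x) * w i x <= 1.
Proof.
move=> x_ge0; have rate_gt0 l := outflow_rate_gt0 l x_ge0.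
move: i; apply: ord_first_next_ind => [i i0|j i ij IH].
  by rewrite station_weight_first// mulfV// gt_eqF.
rewrite (station_weight_next _ ij) mulrA (mulrC (mu i + _)) divfK ?gt_eqF//.
apply: le_trans IH; rewrite ler_wpM2r//.
  by apply: ltW; exact: station_weight_gt0.
by rewrite lerDl mulr_ge0// ltW.
Qed.

Lemma station_weight_le (i : 'I_N) (x : R) : 0 < x -> w i x <= (nu * x)^-1.
Proof.
move=> x_gt0; have nux : 0 < nu * x by rewrite mulr_gt0.
rewrite -[leRHS]mul1r ler_pdivlMr//.
apply: le_trans (station_outflow_le1 i (ltW x_gt0)).
rewrite mulrC ler_wpM2r//; last by rewrite lerDr ltW.
by apply: ltW; apply: station_weight_gt0; exact: ltW.
Qed.

(** The denominator is a polynomial in x without nonnegative root. *)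
Lemma station_weight_continuous (i : 'I_N) (x : R) :
  0 <= x -> {for x, continuous (w i)}.
Proof.
move=> x_ge0; apply: continuousM; first exact: cst_continuous.
apply: continuousV.
  rewrite gt_eqF// prodr_gt0// => l _; exact: outflow_rate_gt0.
pose p : {poly R} := \prod_(l < N | (l <= i)%N) ((mu l)%:P + nu *: 'X).
rewrite (_ : (fun _ => _) = horner p); first exact: continuous_horner.
apply/funext => y; rewrite horner_prod; apply: eq_bigr => l _.
by rewrite !hornerE.
Qed.

Variable lambda : R.
Hypothesis lambda_gt0 : 0 < lambda.

Local Notation f := (fixed_point_fun lambda mu nu).

Lemma fixed_point_fun_decr (x y : R) :
  (0 < N)%N -> 0 <= x -> x < y -> f y < f x.
Proof.
move=> N_gt0 x_ge0 xy; rewrite ltr_pM2l//; apply: ltr_sum.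
  by apply/hasP; exists (Ordinal N_gt0); rewrite ?mem_index_enum.
by move=> i _; exact: station_weight_decr.
Qed.

Lemma fixed_point_fun_inj (x y : R) :
  (0 < N)%N -> 0 <= x -> 0 <= y -> f x = f y -> x = y.
Proof.
move=> N_gt0 x0 y0 fxy; case: (ltgtP x y) => // xy.
  by have := fixed_point_fun_decr N_gt0 x0 xy; rewrite fxy ltxx.
by have := fixed_point_fun_decr N_gt0 y0 xy; rewrite fxy ltxx.
Qed.

Lemma fixed_point_fun_continuous (x : R) :
  0 <= x -> {for x, continuous f}.
Proof.
move=> x_ge0; apply: continuousM; first exact: cst_continuous.
rewrite (_ : (fun _ => _) = \sum_(i < N) w i); last first.
  by apply/funext => y; rewrite fct_sumE.
elim/big_ind: _ => [|g h cg ch|i _]; first exact: cst_continuous.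
  exact: continuousD.
exact: station_weight_continuous.
Qed.

(** At x = 0 each quotient telescopes to (mu i)^-1, which turns the overload
    assumption into a statement about the fixed-point function. *)
Lemma fixed_point_fun0 : f 0 = lambda * \sum_(i < N) (mu i)^-1.
Proof.
congr (_ * _); apply: eq_bigr => i _.
rewrite [X in _ / X](bigD1 i)//= mulr0 addr0 invfM mulrCA.
rewrite [X in _ / X](eq_big (fun l : 'I_N => (l < i)%N) mu).
- by rewrite mulfV ?mulr1// gt_eqF// prodr_gt0.
- by move=> l; rewrite [RHS]ltn_neqAle andbC.
- by move=> l _; rewrite addr0.
Qed.

(** The intermediate value theorem on [0, b]. The right end b makes the bound
    lambda * N / (nu b), obtained from [station_weight_le], equal to 1. *)
Lemma fixed_point_fun_root :
  (0 < N)%N -> 1 < lambda * \sum_(i < N) (mu i)^-1 ->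
  exists2 x, 0 < x & f x = 1.
Proof.
move=> N_gt0 overload; pose b := lambda * N%:R / nu.
have N_pos : 0 < N%:R :> R by rewrite ltr0n.
have b_gt0 : 0 < b by rewrite divr_gt0// mulr_gt0.
have f0_gt1 : 1 < f 0 by rewrite fixed_point_fun0.
have fb_le1 : f b <= 1.
  have -> : 1 = lambda * \sum_(i < N) (nu * b)^-1.
    rewrite sumr_const card_ord -mulr_natl /b.
    by field; rewrite !gt_eqF.
  rewrite ler_pM2l//; apply: ler_sum => i _; exact: station_weight_le.
have f_cont : {within `[0, b], continuous f}.
  apply: continuous_in_subspaceT => x; rewrite inE/= in_itv/= => /andP[x_ge0 _].
  exact: fixed_point_fun_continuous.
have [|x] := IVT (ltW b_gt0) f_cont (v := 1).
  by rewrite ge_min fb_le1 orbT le_max (ltW f0_gt1).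
rewrite in_itv/= => /andP[x_ge0 _] fx1; exists x => //.
rewrite lt_neqAle x_ge0 andbT; apply/eqP => x0.
by move: f0_gt1; rewrite x0 fx1 ltxx.
Qed.

End StationWeight.

(** * Balance equations and invariant solutions *)

(** The equilibrium equations of the fluid dynamics: net drift zero at every
    station. *)
Definition balanced (R : realType) (N : nat) (lambda : R) (mu : 'I_N -> R)
    (nu : R) (c : 'rV[R]_N) : Prop :=
  (forall i : 'I_N, i = 0%N :> nat ->
     lambda - mu i * (c 0 i / norm1 c) - nu * c 0 i = 0) /\
  (forall j i : 'I_N, i = j.+1 :> nat ->
     mu j * (c 0 j / norm1 c) - mu i * (c 0 i / norm1 c) - nu * c 0 i = 0).

Section Equilibria.
Variables (R : realType) (N : nat) (lambda : R) (mu : 'I_N -> R) (nu : R).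
Hypotheses (mu_gt0 : forall i, 0 < mu i) (nu_gt0 : 0 < nu).

(** One balance equation with inflow a, solved for the content y of station i
    with the total mass x frozen; this is where nonlinearity is traded for the
    parameter x. *)
Lemma balance_stepE (a : R) (i : 'I_N) (x y : R) : 0 < x ->
  a - mu i * (y / x) - nu * y = 0 <-> y = a / (mu i + nu * x) * x.
Proof.
move=> x_gt0; have rate_neq0 : mu i + nu * x != 0.
  by rewrite gt_eqF// outflow_rate_gt0// ltW.
have x_neq0 : x != 0 by rewrite gt_eqF.
split=> [eq0|->]; last by field; rewrite x_neq0 rate_neq0.
have -> : a = mu i * (y / x) + nu * y by lra.
by field; rewrite x_neq0 rate_neq0.
Qed.

Lemma balancedE (c : 'rV[R]_N) : 0 < norm1 c ->
  balanced lambda mu nu c <->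
  (forall i : 'I_N, i = 0%N :> nat ->
     c 0 i = lambda / (mu i + nu * norm1 c) * norm1 c) /\
  (forall j i : 'I_N, i = j.+1 :> nat ->
     c 0 i = mu j / (mu i + nu * norm1 c) * c 0 j).
Proof.
move=> c_gt0.
have nextE (j i : 'I_N) : mu j * (c 0 j / norm1 c) / (mu i + nu * norm1 c)
    * norm1 c = mu j / (mu i + nu * norm1 c) * c 0 j.
  field; rewrite (gt_eqF c_gt0) gt_eqF// outflow_rate_gt0//.
  exact: ltW.
split=> -[c_first c_next]; split=> [i i0|j i ij].
- by apply/balance_stepE => //; exact: c_first.
- by rewrite -nextE; apply/balance_stepE => //; exact: c_next.
- by apply/balance_stepE => //; exact: c_first.
- by apply/balance_stepE => //; rewrite nextE; exact: c_next.
Qed.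

(** Unrolling the recursion of [balancedE] from the first station. This is not
    yet a solution formula, as the total mass occurs on both sides. *)
Lemma balanced_weightE (c : 'rV[R]_N) : 0 < norm1 c ->
  balanced lambda mu nu c <->
  forall i, c 0 i = lambda * station_weight mu nu i (norm1 c) * norm1 c.
Proof.
move=> c_gt0; rewrite balancedE//; split=> [[c_first c_next]|cE].
  apply: ord_first_next_ind => [i i0|j i ij cj].
    by rewrite (c_first _ i0) station_weight_first.
  by rewrite (c_next _ _ ij) cj (station_weight_next _ _ _ ij); ring.
split=> [i i0|j i ij]; first by rewrite cE station_weight_first.
by rewrite !cE (station_weight_next _ _ _ ij); ring.
Qed.

Lemma sum_weightE (x : R) :
  \sum_(i < N) (lambda * station_weight mu nu i x * x) =
  fixed_point_fun lambda mu nu x * x.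
Proof. by rewrite /fixed_point_fun mulr_sumr mulr_suml. Qed.

(** The consistency condition on the total mass: the sum of the entries given
    by [balanced_weightE] must be the mass they were computed from. *)
Lemma balanced_fixed_point (c : 'rV[R]_N) :
  (forall i, 0 <= c 0 i) -> 0 < norm1 c -> balanced lambda mu nu c ->
  fixed_point_fun lambda mu nu (norm1 c) = 1.
Proof.
move=> c_ge0 c_gt0 /(balanced_weightE c_gt0) cE.
apply: (mulIf (lt0r_neq0 c_gt0)); rewrite mul1r -sum_weightE.
by rewrite [RHS]/norm1; apply: eq_bigr => i _; rewrite -cE ger0_norm.
Qed.

(** The equations are read at t = 1, an interior point of the half-line on which
    z is constant: z is constant near it, so the derivatives there vanish. *)
Lemma invariant_fms_balanced (z : R -> 'rV[R]_N) (c : 'rV[R]_N) :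
  is_fluid_model_solution lambda mu nu z ->
  (forall t, 0 <= t -> z t = c) ->
  [/\ forall i, 0 <= c 0 i, 0 < norm1 c & balanced lambda mu nu c].
Proof.
move=> [_ z_ge0 z_inf z_first z_next] zc.
have image_norm : [set norm1 (z t) | t in `[1, +oo[] = [set norm1 c].
  apply/seteqP; split=> [_ [t t_ge1 <-]|_ ->] /=.
    rewrite zc//; move: t_ge1; rewrite /= in_itv/= andbT.
    exact: le_trans.
  by exists 1; rewrite ?zc//= in_itv/= lexx.
have der0 (i : 'I_N) (d : R) :
    is_derive (1 : R) (1 : R) (fun s => z s 0 i) d -> d = 0.
  move=> der; rewrite -(derive_val (is_derive := der)).
  rewrite (near_eq_derive (g := cst (c 0 i))) ?derive_cst//.
  near=> s; rewrite zc//; apply: ltW; near: s; exact: lt_nbhsr.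
split=> [i||].
- by rewrite -(zc _ (lexx 0)); exact: z_ge0.
- by have := z_inf _ (@ltr01 R); rewrite image_norm inf1.
split=> [i i0|j i ij].
- by have := der0 _ _ (z_first 1 i ltr01 i0); rewrite zc.
- by have := der0 _ _ (z_next 1 j i ltr01 ij); rewrite zc.
Unshelve. all: by end_near.
Qed.

Lemma balanced_invariant_fms (c : 'rV[R]_N) :
  (forall i, 0 <= c 0 i) -> 0 < norm1 c -> balanced lambda mu nu c ->
  is_invariant_fms lambda mu nu (fun=> c).
Proof.
move=> c_ge0 c_gt0 [c_first c_next]; split; last by exists c.
split=> //.
- by apply: continuous_subspaceT; exact: cst_continuous.
- move=> d d_gt0.
  suff -> : [set norm1 c | _ in `[d, +oo[] = [set norm1 c] by rewrite inf1.
  apply/seteqP; split=> [_ [t _ <-]//|_ ->] /=.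
  by exists d; rewrite //= in_itv/= lexx.
- by move=> t i _ i0; rewrite c_first//; exact: is_derive_cst.
- by move=> t j i _ ij; rewrite c_next//; exact: is_derive_cst.
Qed.

End Equilibria.

(** * The unique invariant solution *)

Theorem theorem2 (R : realType) (N : nat) (lambda : R) (mu : 'I_N -> R)
    (nu : R) (N_ge1 : (1 <= N)%N) (lambda_gt0 : 0 < lambda)
    (mu_gt0 : forall i : 'I_N, 0 < mu i) (nu_gt0 : 0 < nu)
    (overload : 1 < lambda * \sum_(i < N) (mu i)^-1) :
  exists zstar : 'rV[R]_N,
    [/\ is_invariant_fms lambda mu nu (fun=> zstar),
        forall z : R -> 'rV[R]_N, is_invariant_fms lambda mu nu z ->
          forall t : R, 0 <= t -> z t = zstar,
        forall i : 'I_N, i = 0%N :> nat ->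
          zstar 0 i = lambda / (mu i + nu * norm1 zstar) * norm1 zstar,
        forall j i : 'I_N, i = j.+1 :> nat ->
          zstar 0 i = mu j / (mu i + nu * norm1 zstar) * zstar 0 j &
        fixed_point_fun lambda mu nu (norm1 zstar) = 1].
Proof.
have [x x_gt0 fx1] := fixed_point_fun_root mu_gt0 nu_gt0 lambda_gt0 N_ge1 overload.
pose c : 'rV[R]_N := \row_i (lambda * station_weight mu nu i x * x).
have c_ge0 i : 0 <= c 0 i.
  rewrite mxE mulr_ge0 ?(ltW x_gt0)// mulr_ge0 ?(ltW lambda_gt0)//.
  by apply: ltW; apply: station_weight_gt0; rewrite ?ltW.
have c_norm : norm1 c = x.
  rewrite -[RHS]mul1r -fx1 -sum_weightE; apply: eq_bigr => i _.
  by rewrite ger0_norm// mxE.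
have c_gt0 : 0 < norm1 c by rewrite c_norm.
have c_bal : balanced lambda mu nu c.
  by apply/(balanced_weightE _ mu_gt0 nu_gt0 c_gt0) => i; rewrite c_norm mxE.
exists c; have [c_first c_next] := (balancedE _ mu_gt0 nu_gt0 c_gt0).1 c_bal.
split=> //; first exact: balanced_invariant_fms.
  move=> z [z_fms [d zd]] t t_ge0; rewrite zd//.
  have [d_ge0 d_gt0 d_bal] := invariant_fms_balanced z_fms zd.
  have dx : norm1 d = x.
    apply: (fixed_point_fun_inj mu_gt0 nu_gt0 lambda_gt0 N_ge1); rewrite ?ltW//.
    by rewrite fx1; exact: balanced_fixed_point d_bal.
  apply/rowP => i; rewrite mxE.
  by have /(balanced_weightE _ mu_gt0 nu_gt0 d_gt0) -> := d_bal; rewrite dx.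
by rewrite c_norm.
Qed.
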